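(* For each (non-degenerate) triangle $\Delta$ in $\mathbb{R}^2$ one has $$L(\Delta)\;\geq\;2\sqrt{3}\cdot\delta(\Delta),$$ with equality exactly for equilateral triangles.
   Context: A triangle $\Delta$ is understood as the closed polygonal curve formed by its three edges (the boundary curve), with nonempty interior region; $L(\Delta)$ is its perimeter. With $d$ the Euclidean distance, $\delta(\Delta):=\inf_{p\in\Delta}\sup_{q\in\Delta} d(p,q)$, where $p,q$ range over the boundary curve. *)

(* Defs.v *)
From HB Require Import structures.
From mathcomp Require Import all_boot all_order all_algebra.
From mathcomp Require Import all_classical all_reals.
From mathcomp Require Import topology normedtype.

Set Implicit Arguments.
Unset Strict Implicit.
Unset Printing Implicit Defensive.

Import Order.TTheory GRing.Theory Num.Theory.
Import numFieldNormedType.Exports.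

Local Open Scope classical_set_scope.
Local Open Scope ring_scope.

(* The library norm on 'rV[R]_n is the sup norm, so the Euclidean distance is
   written out explicitly; both induce the same topology. *)
Definition eucl_dist (R : realType) (n : nat) (p q : 'rV[R]_n) : R :=
  Num.sqrt (\sum_(i < n) (p 0 i - q 0 i) ^+ 2).

(* delta(X) = inf_{p in X} sup_{q in X} d(p, q).  The real-valued [inf] and
   [sup] return 0 on sets that are empty or not suitably bounded, so this is
   meaningful only for nonempty bounded X. *)
Definition delta (R : realType) (n : nat) (X : set 'rV[R]_n) : R :=
  inf [set sup [set eucl_dist p q | q in X] | p in X].

Definition segment (R : realType) (n : nat) (A B : 'rV[R]_n) : set 'rV[R]_n :=
  [set (1 - t) *: A + t *: B | t in `[0, 1]%classic].

Definition triangle (R : realType) (A B C : 'rV[R]_2) : set 'rV[R]_2 :=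
  segment A B `|` segment B C `|` segment C A.

Definition solid_triangle (R : realType) (A B C : 'rV[R]_2) : set 'rV[R]_2 :=
  [set p | exists a b c : R, [/\ 0 <= a, 0 <= b, 0 <= c, a + b + c = 1
                               & p = a *: A + b *: B + c *: C]].

(* The region bounded by the curve is the topological interior of the convex
   hull of the vertices; it is empty exactly when A, B, C are collinear. *)
Definition nondegenerate_triangle (R : realType) (A B C : 'rV[R]_2) : Prop :=
  (solid_triangle A B C)° !=set0.

Definition perimeter (R : realType) (A B C : 'rV[R]_2) : R :=
  eucl_dist A B + eucl_dist B C + eucl_dist C A.

Definition equilateral (R : realType) (A B C : 'rV[R]_2) : Prop :=
  eucl_dist A B = eucl_dist B C /\ eucl_dist B C = eucl_dist C A.

(* Main.v *)
Require Import Defs.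
From mathcomp Require Import all_boot all_order all_algebra.
From mathcomp Require Import all_classical all_reals.
From mathcomp Require Import topology normedtype.
From mathcomp Require Import ring lra.

Import Order.TTheory GRing.Theory Num.Theory.
Import numFieldNormedType.Exports.

Local Open Scope classical_set_scope.
Local Open Scope ring_scope.

(** The farthest point of a triangle from a given point is a vertex, because
    balls are convex. Let a, b <= c be the sides and take for p the midpoint of
    the longest one: its farthest vertex is at distance c/2 or m, where m is the
    median with 4 m^2 = 2 a^2 + 2 b^2 - c^2. Since 2 sqrt 3 (c/2) <= 2 c <= L
    and 12 m^2 <= L^2, with equality only if a = b = c, this p gives the
    inequality and its rigidity. Conversely, in an equilateral triangle every
    boundary point is at least an altitude away from the opposite vertex. *)

Set Implicit Arguments.
Unset Strict Implicit.

(** * Stewart's theorem and distances to the points of a segment *)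

Section EuclideanDistance.
Variables (R : realType) (n : nat).
Implicit Types (p q A B C : 'rV[R]_n).

Lemma eucl_dist_ge0 p q : 0 <= eucl_dist p q.
Proof. exact: sqrtr_ge0. Qed.

Lemma sqr_eucl_dist p q :
  eucl_dist p q ^+ 2 = \sum_(i < n) (p 0 i - q 0 i) ^+ 2.
Proof. by rewrite sqr_sqrtr// sumr_ge0// => i _; exact: sqr_ge0. Qed.

Lemma eucl_distC p q : eucl_dist p q = eucl_dist q p.
Proof.
congr Num.sqrt; apply: eq_bigr => i _.
by rewrite -sqrrN opprB.
Qed.

Lemma eucl_distxx p : eucl_dist p p = 0.
Proof.
rewrite /eucl_dist big1 ?sqrtr0// => i _.
by rewrite subrr expr0n.
Qed.

(** Stewart's theorem, a polynomial identity in each coordinate. It yields the triangle inequality,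
    the convexity of balls, the altitude bound and the length of the median. *)
Lemma stewart p A B (t : R) :
  eucl_dist p ((1 - t) *: A + t *: B) ^+ 2 =
  (1 - t) * eucl_dist p A ^+ 2 + t * eucl_dist p B ^+ 2
    - t * (1 - t) * eucl_dist A B ^+ 2.
Proof.
rewrite !sqr_eucl_dist !mulr_sumr -sumrN -!big_split /=.
by apply: eq_bigr => i _; rewrite !mxE; ring.
Qed.

(* In Stewart's identity the right-hand side is a quadratic polynomial in t
   which is nonnegative everywhere; t below is its minimum point. *)
Lemma eucl_dist_triangle p A B :
  eucl_dist A B <= eucl_dist p A + eucl_dist p B.
Proof.
have := eucl_dist_ge0 p A; have := eucl_dist_ge0 p B.
have := eucl_dist_ge0 A B.
pose t := (eucl_dist A B ^+ 2 + eucl_dist p A ^+ 2 - eucl_dist p B ^+ 2)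
          / (2 * eucl_dist A B ^+ 2).
have := sqr_ge0 (eucl_dist p ((1 - t) *: A + t *: B)).
rewrite stewart {}/t.
move: (eucl_dist A B) (eucl_dist p A) (eucl_dist p B) => c a b.
rewrite [in X in _ -> X]le_eqVlt => quad_ge0 /predU1P[<- *|c_gt0 b_ge0 a_ge0].
  exact: addr_ge0.
have c_neq0 : c != 0 by rewrite gt_eqF.
(* The minimum of the quadratic times [4 * c ^+ 2]; this is Heron's expression for 16 times the
   squared area. *)
have disc : 0 <= 4 * a ^+ 2 * c ^+ 2 - (c ^+ 2 + a ^+ 2 - b ^+ 2) ^+ 2.
  have : 0 <= 4 * c ^+ 2 by rewrite mulr_ge0 ?sqr_ge0.
  move=> /mulr_ge0/(_ quad_ge0); congr (0 <= _); field.
  by rewrite c_neq0.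
rewrite leNgt; apply/negP => ab_lt_c.
have : 2 * a * c < c ^+ 2 + a ^+ 2 - b ^+ 2 by nra.
have ac_ge0 : 0 <= 2 * a * c by rewrite !mulr_ge0// ltW.
nra.
Qed.

Lemma segmentl A B : segment A B A.
Proof.
exists 0; first by rewrite /= in_itv /= lexx ler01.
by rewrite subr0 scale1r scale0r addr0.
Qed.

Lemma segmentC A B : segment A B = segment B A.
Proof.
suff sub A' B' : segment A' B' `<=` segment B' A' by apply/seteqP; split.
move=> _ [t /= ht <-]; exists (1 - t); last by rewrite subKr addrC.
by move: ht; rewrite /= !in_itv /= => /andP[? ?]; apply/andP; split; lra.
Qed.

Lemma segmentr A B : segment A B B.
Proof. by rewrite segmentC; exact: segmentl. Qed.

(** Without its nonpositive last term, Stewart's right-hand side is a convex combination of two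
    squares that are at most [M ^+ 2]. *)
Lemma eucl_dist_segment_le p A B q (M : R) : 0 <= M ->
  eucl_dist p A <= M -> eucl_dist p B <= M -> segment A B q ->
  eucl_dist p q <= M.
Proof.
move=> M_ge0 pA pB [t]; rewrite /= in_itv /= => /andP[t0 t1] <-.
rewrite -(@ler_pXn2r _ 2)// ?nnegrE ?eucl_dist_ge0// stewart.
have pA2 : eucl_dist p A ^+ 2 <= M ^+ 2.
  by rewrite ler_pXn2r// nnegrE eucl_dist_ge0.
have pB2 : eucl_dist p B ^+ 2 <= M ^+ 2.
  by rewrite ler_pXn2r// nnegrE eucl_dist_ge0.
have t1' : 0 <= 1 - t by rewrite subr_ge0.
have := mulr_ge0 (mulr_ge0 t0 t1') (sqr_ge0 (eucl_dist A B)).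
have := ler_wpM2l t1' pA2; have := ler_wpM2l t0 pB2.
lra.
Qed.

(* sqrt 3 / 2 * s is the altitude of an equilateral triangle of side s. *)
Lemma altitude_le_eucl_dist A B C p (s : R) : 0 <= s ->
  eucl_dist A B = s -> eucl_dist C A = s -> eucl_dist C B = s ->
  segment A B p -> Num.sqrt 3 / 2 * s <= eucl_dist p C.
Proof.
move=> s_ge0 AB CA CB [t _ <-]; rewrite eucl_distC.
rewrite -(@ler_pXn2r _ 2)// ?nnegrE ?eucl_dist_ge0//; last first.
  by rewrite mulr_ge0// divr_ge0// sqrtr_ge0.
rewrite stewart AB CA CB !exprMn sqr_sqrtr//.
(* The squared distance is s^2 (1 - t + t^2) = 3/4 s^2 + 1/4 s^2 (1 - 2 t)^2. *)
have := sqr_ge0 (s * (1 - 2 * t)); nra.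
Qed.

End EuclideanDistance.

(** * Upper and lower bounds for the inf-sup *)

Section Delta.
Variables (R : realType) (n : nat) (X : set 'rV[R]_n).

Lemma delta_le (p : 'rV[R]_n) (M : R) : X p ->
  (forall q, X q -> eucl_dist p q <= M) -> delta X <= M.
Proof.
move=> Xp pM; apply: (@le_trans _ _ (sup [set eucl_dist p q | q in X])).
  apply: ge_inf; last by exists p.
  (* 0 bounds every supremum from below, also one that takes the default value 0. *)
  exists 0 => _ [q _ <-].
  have [[[_ [r Xr _]] ubd]|] :=
      pselect (has_sup [set eucl_dist q r | r in X]).
    apply: le_trans (eucl_dist_ge0 q r) _; apply: ub_le_sup => //.
    by exists r.
  by move=> ?; rewrite sup_out.
apply: ge_sup; first by exists (eucl_dist p p), p.
by move=> _ [q Xq <-]; exact: pM.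
Qed.

Lemma delta_ge (m : R) : X !=set0 ->
  (forall p, X p -> has_ubound [set eucl_dist p q | q in X]) ->
  (forall p, X p -> exists2 q, X q & m <= eucl_dist p q) ->
  m <= delta X.
Proof.
move=> [x Xx] Xbd far; apply: lb_le_inf.
  by exists (sup [set eucl_dist x q | q in X]), x.
move=> _ [p Xp <-]; have [q Xq /le_trans] := far p Xp; apply.
by apply: ub_le_sup; [exact: Xbd | exists q].
Qed.

End Delta.

(** * The inequality, its rigidity and the equilateral case *)

Section Triangle.
Variable R : realType.
Implicit Types (A B C p : 'rV[R]_2).

Lemma triangle_rot A B C : triangle A B C = triangle B C A.
Proof. by rewrite /triangle -setUA setUC. Qed.

Lemma perimeter_rot A B C : perimeter A B C = perimeter B C A.
Proof. by rewrite /perimeter -addrA addrC. Qed.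

Lemma equilateral_rot A B C : equilateral A B C <-> equilateral B C A.
Proof. by rewrite /equilateral; split=> -[-> ->]. Qed.

Lemma eucl_dist_triangle_le A B C p q (M : R) :
  eucl_dist p A <= M -> eucl_dist p B <= M -> eucl_dist p C <= M ->
  triangle A B C q -> eucl_dist p q <= M.
Proof.
move=> pA pB pC; have M_ge0 : 0 <= M := le_trans (eucl_dist_ge0 _ _) pA.
by move=> [[]|]; exact: eucl_dist_segment_le.
Qed.

Lemma has_ubound_triangle A B C p :
  has_ubound [set eucl_dist p q | q in triangle A B C].
Proof.
exists (eucl_dist p A + eucl_dist p B + eucl_dist p C) => _ [q tq <-].
by apply: (eucl_dist_triangle_le _ _ _ tq);
  have := eucl_dist_ge0 p A; have := eucl_dist_ge0 p B;
  have := eucl_dist_ge0 p C; lra.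
Qed.

Lemma delta_equilateral_ge A B C : equilateral A B C ->
  Num.sqrt 3 / 2 * eucl_dist A B <= delta (triangle A B C).
Proof.
move=> [AB BC]; set s := eucl_dist A B.
have s_ge0 : 0 <= s by exact: eucl_dist_ge0.
have dBC : eucl_dist B C = s by rewrite -AB.
have dCA : eucl_dist C A = s by rewrite -BC.
apply: delta_ge; first by exists A; left; left; exact: segmentl.
  by move=> p _; exact: has_ubound_triangle.
move=> p [[]|] hp.
- exists C; first by left; right; exact: segmentr.
  by apply: (@altitude_le_eucl_dist _ _ A B) => //; rewrite eucl_distC.
- exists A; first by left; left; exact: segmentl.
  by apply: (@altitude_le_eucl_dist _ _ B C) => //; rewrite eucl_distC.
- exists B; first by left; left; exact: segmentr.
  by apply: (@altitude_le_eucl_dist _ _ C A) => //; rewrite eucl_distC.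
Qed.

(* The difference of the two sides is
   c (x + y) + 2 x y + 5 a x + 5 b y  with  x = c - a, y = c - b. *)
Lemma median_perimeter_le (a b c : R) : 0 <= a -> 0 <= b -> a <= c -> b <= c ->
  3 * (2 * a ^+ 2 + 2 * b ^+ 2 - c ^+ 2) + c * ((c - a) + (c - b))
    <= (a + b + c) ^+ 2.
Proof.
rewrite -(subr_ge0 a) -(subr_ge0 b) => a0 b0 x0 y0.
have := mulr_ge0 x0 y0; have := mulr_ge0 a0 x0; have := mulr_ge0 b0 y0.
lra.
Qed.

Lemma perimeter_delta_longest A B C :
  eucl_dist B C <= eucl_dist A B -> eucl_dist C A <= eucl_dist A B ->
  2 * Num.sqrt 3 * delta (triangle A B C) <= perimeter A B C /\
  (perimeter A B C = 2 * Num.sqrt 3 * delta (triangle A B C) ->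
    equilateral A B C).
Proof.
pose p := (1 - 2^-1) *: A + 2^-1 *: B.
have half_ge0 : (0 : R) <= 2^-1 by rewrite invr_ge0.
have inABC : triangle A B C p.
  left; left; exists 2^-1 => //.
  by rewrite /= in_itv /=; apply/andP; split; lra.
have dAp : eucl_dist p A <= eucl_dist A B / 2.
  rewrite -(@ler_pXn2r _ 2)// ?nnegrE ?divr_ge0 ?eucl_dist_ge0//.
  by rewrite eucl_distC stewart eucl_distxx; lra.
have dBp : eucl_dist p B <= eucl_dist A B / 2.
  rewrite -(@ler_pXn2r _ 2)// ?nnegrE ?divr_ge0 ?eucl_dist_ge0//.
  by rewrite eucl_distC stewart eucl_distxx (eucl_distC B); lra.
have median := stewart C A B 2^-1; rewrite -/p eucl_distC in median.
have dM :
    delta (triangle A B C) <= Num.max (eucl_dist A B / 2) (eucl_dist p C).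
  apply: (delta_le inABC) => q; apply: eucl_dist_triangle_le.
  - by rewrite le_max dAp.
  - by rewrite le_max dBp.
  - by rewrite le_max lexx orbT.
move: dM.
have := eucl_dist_triangle C A B.
have := eucl_dist_ge0 A B; have := eucl_dist_ge0 B C; have := eucl_dist_ge0 C A.
have := eucl_dist_ge0 p C.
rewrite /perimeter /equilateral (eucl_distC C B) in median *.
move: (delta _) (eucl_dist p C) (eucl_dist A B) (eucl_dist B C) (eucl_dist C A)
  median => d m c a b median m0 b0 a0 c0 tri dM ac bc.
have s2 : Num.sqrt 3 ^+ 2 = 3 :> R by rewrite sqr_sqrtr.
have s0 : 0 <= Num.sqrt 3 :> R := sqrtr_ge0 _.
have s_lt2 : Num.sqrt 3 < 2 :> R by nra.
move: (Num.sqrt 3) s2 s0 s_lt2 => s s2 s0 s_lt2.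
move: dM; rewrite le_max => /orP[dc|dm].
  (* Here 2 s d <= s c <= 2 c <= a + b + c. As s < 2, equality forces c = 0, and then all sides
     vanish. *)
  have sd : 2 * s * d <= s * c by nra.
  split; first by nra.
  move=> e; have c00 : c = 0 by apply/eqP; rewrite eq_le c0 andbT; nra.
  by split; lra.
have gap := median_perimeter_le a0 b0 ac bc.
have sd : 2 * s * d <= 2 * s * m by nra.
(* The extra term on the left measures the deviation from a = b = c; equality in the theorem makes
   it vanish. *)
have sm2 : (2 * s * m) ^+ 2 + c * ((c - a) + (c - b)) <= (a + b + c) ^+ 2.
  by rewrite !exprMn s2 median; lra.
have xy0 : 0 <= c * ((c - a) + (c - b)) by apply: mulr_ge0; lra.
have sm : 2 * s * m <= a + b + c.
  rewrite -(@ler_pXn2r _ 2)// ?nnegrE; [lra | | lra].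
  by rewrite !mulr_ge0.
split; first by lra.
move=> e; have smE : 2 * s * m = a + b + c by lra.
have /eqP : c * ((c - a) + (c - b)) = 0 by rewrite smE in sm2; lra.
by rewrite mulf_eq0 => /orP[] /eqP ?; split; lra.
Qed.

(** Everything is invariant under cyclic rotation of the vertices, so at most two rotations make
    [A B] the longest side. *)
Lemma perimeter_delta A B C :
  2 * Num.sqrt 3 * delta (triangle A B C) <= perimeter A B C /\
  (perimeter A B C = 2 * Num.sqrt 3 * delta (triangle A B C) ->
    equilateral A B C).
Proof.
have [BC|BC] := leP (eucl_dist B C) (eucl_dist A B);
  have [CA|CA] := leP (eucl_dist C A) (eucl_dist A B);
  have [CB|CB] := leP (eucl_dist C A) (eucl_dist B C);
  try by apply: perimeter_delta_longest.
all: rewrite triangle_rot perimeter_rot equilateral_rot.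
all: try by apply: perimeter_delta_longest => //; lra.
all: rewrite triangle_rot perimeter_rot equilateral_rot.
all: by apply: perimeter_delta_longest => //; lra.
Qed.

End Triangle.

Unset Implicit Arguments.

Theorem theorem6p1 (R : realType) (A B C : 'rV[R]_2)
    (hABC : nondegenerate_triangle A B C) :
  perimeter A B C >= 2 * Num.sqrt 3 * delta (triangle A B C) /\
  (perimeter A B C = 2 * Num.sqrt 3 * delta (triangle A B C)
     <-> equilateral A B C).
Proof.
have [ineq rigid] := perimeter_delta A B C.
split=> //; split=> // eqABC; apply/eqP; rewrite eq_le ineq andbT.
have lb := delta_equilateral_ge eqABC.
have s2 : Num.sqrt 3 ^+ 2 = 3 :> R by rewrite sqr_sqrtr.
(* Three equal sides add up to 2 sqrt 3 times the altitude. *)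
have -> : perimeter A B C = 2 * Num.sqrt 3 * (Num.sqrt 3 / 2 * eucl_dist A B).
  case: eqABC => AB BC; rewrite /perimeter -BC -AB.
  have -> : 2 * Num.sqrt 3 * (Num.sqrt 3 / 2 * eucl_dist A B) =
    Num.sqrt 3 ^+ 2 * eucl_dist A B by field.
  by rewrite s2; ring.
by rewrite ler_wpM2l// mulr_ge0// sqrtr_ge0.
Qed.
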